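(* For each $k\in\mathbb{N}$, $$|\mathcal{S}_{k,n}| = \begin{cases}0, &\text{if } 1\le n\le 3k-3;\\ \frac{1}{k+1}\binom{2k}{k}, &\text{if } n=3k-2;\\ \frac{3}{2k+1}\binom{2k+1}{k+2}, &\text{if } n=3k-1.\end{cases}$$ For $n\ge 3k$ (with $n\ge 3$ when $k=1$), $$|\mathcal{S}_{k,n}|-|\mathcal{S}_{k,n-1}|-|\mathcal{S}_{k,n-2}| = \begin{cases}0, &\text{if } k=1;\\ 1, &\text{if } k=2;\\ n-4, &\text{if } k=3;\\ \frac{1}{(k-2)!}\left(\prod_{i=k}^{2k-4}(n-i)\right)(n-3k+5), &\text{if } k\ge 4.\end{cases}$$
   Context: $\mathbb{N}=\{1,2,3,\ldots\}$. For a set $F\subset\mathbb{N}$ and $r\le |F|$, $\min_r F$ denotes the $r$th smallest integer in $F$. For $k\in\mathbb{N}$, a nonempty finite set $F\subset\mathbb{N}$ is $k$-super-Schreier if $|F|\ge k$ and $\min_r F\ge |F|+2r-2$ for all integers $r\in[1,k]$. For $k,n\in\mathbb{N}$, $$\mathcal{S}_{k,n} := \{F\subset\{1,2,\ldots,n\} : F\text{ is }k\text{-super-Schreier and }n\in F\}.$$ *)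

(* Defs.v *)
From HB Require Import structures.
From mathcomp Require Import all_boot all_order all_algebra.
From mathcomp Require Import finmap.

Set Implicit Arguments.
Unset Strict Implicit.
Unset Printing Implicit Defensive.

Local Open Scope fset_scope.
Local Open Scope nat_scope.

(* The rank [r] is counted from 1; the value is only meaningful for
   [1 <= r <= #|` F|] (it is 0 for [r] larger than [#|` F|]). *)
Definition minr (r : nat) (F : {fset nat}) : nat := nth 0 (sort leq F) r.-1.

(* As [1 <= r], the subtraction in [#|` F| + 2 * r - 2] never truncates.
   Sets containing 0 are excluded when [0 < k], since then
   [minr 1 F >= #|` F| >= 1]. *)
Definition super_schreier (k : nat) (F : {fset nat}) : bool :=
  [&& F != fset0, k <= #|` F|
    & all (fun r => #|` F| + 2 * r - 2 <= minr r F) (iota 1 k)].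

Definition interval1 (n : nat) : {fset nat} := [fset i in iota 1 n].

Definition SSch (k n : nat) : {fset {fset nat}} :=
  [fset F in fpowerset (interval1 n) | super_schreier k F && (n \in F)].

(* Main.v *)
Require Import Defs.
From HB Require Import structures.
From mathcomp Require Import all_boot all_order all_algebra.
From mathcomp Require Import finmap.
From mathcomp Require Import zify ring lra.
Import Order.TTheory GRing.Theory Num.Theory.
Local Open Scope fset_scope.
Local Open Scope nat_scope.

(** For a k-super-Schreier set F with m elements and largest element n, list
    the other elements in increasing order and subtract m - 1 from each. This
    gives m - 1 integers c_1 < c_2 < ... in [1, n - m] with c_r >= 2r - 1 for
    r <= k, and every such list comes from a set F, as long as n itself meets
    its bound when m = k (i.e. n >= 3k - 2). Read it as a path that starts
    at 0 and has n - m steps, down at each c_r and up elsewhere: the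
    constraint says that the path avoids -2 during its first 2k - 2 steps.
    Write P(N, j) for the number of such lists with
    j entries in [1, N], so that
    |S_(k,n)| = sum of P(n - 1 - j, j) over k - 1 <= j < n - 2k + 2
    (card_SSch). In particular the sum is empty for n <= 3k - 3.

    Removing N + 1 from a list shows that P satisfies the Pascal rule
    P(N + 1, j + 1) = P(N, j + 1) + P(N, j) once N >= 2k - 2
    (size_stairS), and that in the constrained range j <= k, 2j <= N + 2 it has
    the closed form C(N, j) - C(N, j - 2) of the reflection principle
    (size_stair_ballot). It vanishes when j >= k and N <= 2k - 2
    (size_stair_eq0).

    All summands for n >= 3k but the last, which vanishes, obey the Pascal
    rule, so the diagonal sums satisfy the Fibonacci recurrence up to one
    boundary term. Splitting P(n - 1 - j, j) into
    P((n - 1) - 1 - j, j) + P((n - 2) - 1 - (j - 1), j - 1) reproduces the sum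
    for n - 1, and the sum for n - 2 plus the summand of index k - 2, which is
    P(n - k - 1, k - 2) (card_SSch_rec). At n = 3k - 2 and n = 3k - 1 a single
    nonzero summand is left. In all three cases the closed form turns the
    answer into a difference of two binomial coefficients, which is evaluated
    over the rationals by writing it with factorials. *)

(** * Increasing lists with lower bounds on their entries *)

(** The increasing lists of [j] integers in [[1, N]] whose entry of index [i],
    counted from 0, exceeds [f i]. The bound is strict so that [f i = 0] means
    no constraint beyond positivity, and the recursion is on the largest value
    allowed, since the Pascal rule arises from removing that value. *)
Fixpoint incs (f : nat -> nat) (N j : nat) : seq (seq nat) :=
  match j, N with
  | 0, _ => [:: [::]]
  | _, 0 => [::]
  | j'.+1, N'.+1 =>
    incs f N' j ++
    (if f j' <= N' then [seq rcons s N | s <- incs f N' j'] else [::])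
  end.

Lemma incs0 f N : incs f N 0 = [:: [::]].
Proof. by case: N. Qed.

(** The induction compares the last entry with the largest value [N.+1]: it
    is either smaller, and the list belongs to the first half, or equal, and
    removing it leaves a list of the second half. *)
Lemma mem_incs f N j s :
  (s \in incs f N j) =
  [&& size s == j, sorted ltn s, all (leq^~ N) s
    & all (fun i => f i < nth 0 s i) (iota 0 j)].
Proof.
elim: N j s => [|N IHN] [|j] s; rewrite ?incs0 ?inE.
- by case: s.
- case: s => [|x s] //=.
  by case: x => [|x] /=; rewrite ?ltn0 ?andbF.
- by case: s.
rewrite [incs _ _ _]/= mem_cat IHN; case/lastP: s => [|t x].
  by rewrite /=; case: ifP => // _; apply/mapP => -[[|y u] _].
have -> : (rcons t x \in (if f j <= N then [seq rcons s N.+1 | s <- incs f N j]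
          else [::])) = [&& f j <= N, x == N.+1 & t \in incs f N j].
  case: ifP => //= _; apply/mapP/andP => [[u ut /rcons_inj[-> ->]]|[/eqP-> tu]].
    by rewrite eqxx.
  by exists t.
have iota_rcons : iota 0 j.+1 = rcons (iota 0 j) j by rewrite -addn1 iotaD cats1.
rewrite IHN !(sorted_pairwise ltn_trans) pairwise_rcons size_rcons eqSS.
rewrite iota_rcons !all_rcons nth_rcons.
have [tj|] := boolP (size t == j); last by rewrite !andbF.
rewrite (eqP tj) ltnn eqxx /=.
have -> : all (fun i => f i < nth 0 (rcons t x) i) (iota 0 j)
        = all (fun i => f i < nth 0 t i) (iota 0 j).
  by apply: eq_in_all => i; rewrite mem_iota nth_rcons (eqP tj) => /andP[_ ->].
case: (ltngtP x N.+1) => [lt|gt|->]; rewrite ?andbF ?orbF /=.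
- rewrite -ltnS lt /=.
  have [ax|] //= := boolP (all (ltn^~ x) t).
  have bound M : x <= M.+1 -> all (leq^~ M) t.
    by move=> le_xM; apply: sub_all ax => y /= lt_yx; rewrite -ltnS (leq_trans lt_yx).
  by rewrite !bound // ?leqW // ltnW.
- by rewrite [x <= N]leqNgt (ltnW gt) andbF.
- rewrite ltnn /= ltnS.
  rewrite [all (fun y => y < N.+1) t](eq_all (_ : _ =1 leq^~ N)) //.
  have [h|_] /= := boolP (all (leq^~ N) t); last by rewrite !andbF.
  rewrite (sub_all _ h) /=; last by move=> y /= /leqW.
  by rewrite andbF orFb andbCA.
Qed.

Lemma uniq_incs f N j : uniq (incs f N j).
Proof.
elim: N j => [|N IHN] [|j] //=.
rewrite cat_uniq IHN /=; case: ifP => //= _.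
rewrite map_inj_uniq ?IHN ?andbT; last by move=> s t /rcons_inj[].
apply/hasPn => _ /mapP[s _ ->]; rewrite mem_incs all_rcons.
by rewrite ltnn !andbF.
Qed.

Lemma size_incsS f N j :
  size (incs f N.+1 j.+1) =
  size (incs f N j.+1) + (f j <= N) * size (incs f N j).
Proof. by rewrite /= size_cat; case: ifP; rewrite ?size_map ?mul1n. Qed.

(** Imposing that the maximum equals the largest allowed value selects the
    second half of the recursion; this accounts for the condition [n \in F]. *)
Lemma count_incs_top f N j :
  count (fun s => N.+1 \in s) (incs f N.+1 j.+1) =
  (f j <= N) * size (incs f N j).
Proof.
rewrite /= count_cat.
rewrite (_ : count _ (incs f N j.+1) = 0); last first.
  apply/eqP; rewrite -leqn0 leqNgt -has_count; apply/hasPn => s.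
  rewrite mem_incs => /and4P[_ _ /allP le_sN _].
  by apply/negP => /le_sN; rewrite ltnn.
case: ifP => // _; rewrite mul1n count_map -[RHS]count_predT.
by apply: eq_count => s /=; rewrite mem_rcons mem_head.
Qed.

(** Subtracting [a] from every entry is a bijection. It removes the
    dependency of the bounds on the size of the set. *)
Lemma size_incs_shift f a N j :
  size (incs (fun i => a + f i) (a + N) j) = size (incs f N j).
Proof.
elim: N j => [|N IHN] [|j]; rewrite ?incs0 //; last first.
  by rewrite addnS !size_incsS !IHN leq_add2l.
rewrite addn0 [RHS]/=.
(* When all the bounds are at least [a], no entry fits below [a]. *)
suff H b : b <= a -> size (incs (fun i => a + f i) b j.+1) = 0 by exact: H.
elim: b => [//|b IHb] lt_ba.
by rewrite size_incsS IHb ?(ltnW lt_ba)// leqNgt ltn_addr.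
Qed.

(** * Super-Schreier sets as increasing lists *)

(** The bound for the ballot condition: the entry of rank [r = i.+1] is at
    least [2 * r - 1] for [r <= k]. *)
Definition stair (k i : nat) : nat := if i < k then 2 * i else 0.

Lemma sort_fset_inj : injective (fun F : {fset nat} => sort leq F).
Proof.
move=> F G eqFG; apply/fsetP => x.
by rewrite -[x \in F](mem_sort leq) eqFG mem_sort.
Qed.

(** Sorting identifies the sets of size [j.+1] with lists: the condition
    [minr r F >= #|F| + 2 * r - 2] reads [minr r F > j + 2 * (r - 1)] and only
    concerns [r <= k]. *)
Lemma perm_SSch_incs k n j : 0 < k <= j.+1 ->
  perm_eq [seq sort leq F | F : {fset nat} <- SSch k n & #|` F| == j.+1]
    [seq s <- incs (fun i => j + stair k i) n j.+1 | n \in s].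
Proof.
move=> /andP[k_gt0 le_kj].
apply: uniq_perm; rewrite ?filter_uniq ?uniq_incs //.
  rewrite map_inj_uniq; last exact: sort_fset_inj.
  by rewrite filter_uniq ?fset_uniq.
(* Beyond rank [k] the bound on the entries is [j], which they inherit from
   the first entry by monotonicity. *)
have lows s : size s = j.+1 -> sorted ltn s ->
   all (fun r => size s + 2 * r - 2 <= nth 0 s r.-1) (iota 1 k) =
   all (fun i => j + stair k i < nth 0 s i) (iota 0 j.+1).
  move=> sz_s srt; apply/allP/allP => [H i | H r]; rewrite mem_iota.
    move=> /andP[_ lt_ij].
    have H0 : j < nth 0 s 0 by have := H 1; rewrite mem_iota sz_s /=; lia.
    rewrite /stair; case: (ltnP i k) => [lt_ik|le_ki].
      by have := H i.+1; rewrite mem_iota sz_s /=; lia.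
    rewrite addn0 (leq_trans H0) //.
    case: i lt_ij le_ki => [//|i] lt_ij _.
    by apply/ltnW/(sorted_ltn_nth ltn_trans) => //; rewrite inE sz_s.
  case: r => // r /andP[_ lt_rk]; have := H r.
  by rewrite mem_iota /stair sz_s /=; case: (ltnP r k) => //; lia.
move=> s; rewrite mem_filter mem_incs.
apply/mapP/idP => [[F]|].
  rewrite mem_filter => /andP[/eqP szF FS] ->.
  move: FS; rewrite !inE /= => /and3P[sub /and3P[_ _ low] nF].
  have srt : sorted ltn (sort leq F).
    by rewrite ltn_sorted_uniq_leq sort_uniq fset_uniq sort_sorted //; exact: leq_total.
  have sz : size (sort leq F) = j.+1 by rewrite size_sort.
  have len : all (leq^~ n) (sort leq F).
    apply/allP => x; rewrite mem_sort => xF.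
    by move: sub; rewrite fpowersetE => /fsubsetP/(_ _ xF); rewrite !inE mem_iota; lia.
  rewrite mem_sort; apply/and5P; split => //; first by rewrite sz.
  by have := lows _ sz srt; rewrite size_sort [X in X = _]low => /esym.
case/and5P => ns /eqP sz srt len low.
have us : uniq s by apply: (sorted_uniq ltn_trans ltnn).
have E : sort leq [fset x in s] = s.
  apply: (sorted_eq leq_trans anti_leq); first by apply: sort_sorted; exact: leq_total.
    by move: srt; rewrite ltn_sorted_uniq_leq => /andP[].
  rewrite perm_sort; apply: uniq_perm; rewrite ?fset_uniq // => x.
  by rewrite !inE.
have card : #|` [fset x in s]| = j.+1 by rewrite -[LHS](size_sort leq) E.
exists [fset x in s] => //.
rewrite mem_filter card eqxx !inE /= ns andbT /super_schreier card le_kj /minr E.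
have := lows s sz srt; rewrite sz low => ->; rewrite !andbT; apply/andP; split; last first.
  by rewrite -cardfs_gt0 card.
rewrite fpowersetE; apply/fsubsetP => x; rewrite !inE /= => xs.
rewrite mem_iota add1n ltnS (allP len) // andbT.
have : index x s < j.+1 by rewrite -sz index_mem.
move=> lt_x; have := allP low (index x s); rewrite mem_iota add0n /= lt_x.
by rewrite nth_index // => /(_ isT); apply: leq_ltn_trans.
Qed.

(** The factor in front is the bound on the largest element [n] itself. *)
Lemma card_SSch_rank k n j : 0 < k <= j.+1 ->
  count (fun F : {fset nat} => #|` F| == j.+1) (SSch k n) =
  (j + stair k j < n) * size (incs (stair k) (n - j.+1) j).
Proof.
move=> kj; rewrite -size_filter -(size_map (fun F : {fset nat} => sort leq F)).
rewrite (perm_size (perm_SSch_incs _ n _ kj)) size_filter.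
case: n => [|n]; first by [].
rewrite count_incs_top subSS ltnS.
case: leqP => // le_jn; rewrite !mul1n.
by rewrite -{1}(subnKC (leq_trans (leq_addr _ _) le_jn)) size_incs_shift.
Qed.

(** * Counting ballot lists *)

(** The entry of rank [i] would have to be at least [2 * i - 1]. *)
Lemma size_stair_eq0 k i N j : 0 < i <= k -> i <= j -> N <= 2 * i.-1 ->
  size (incs (stair k) N j) = 0.
Proof.
move=> /andP[i_gt0 le_ik]; elim: N j => [|N IHN] [|j] le_ij ltN //; try lia.
have -> : size (incs (stair k) N.+1 j.+1) = (stair k j <= N) * size (incs (stair k) N j).
  by rewrite size_incsS IHN //; lia.
have [le_i_j|lt_ji] := leqP i j; first by rewrite IHN ?muln0 //; lia.
by rewrite /stair ifT 1?leqNgt 1?(_ : N < 2 * j) //; lia.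
Qed.

(** Once [N >= 2 * k - 2], the new value [N.+1] exceeds all the bounds, so it
    may be appended at any rank. *)
Lemma size_stairS k N j : 2 * k <= N + 2 ->
  size (incs (stair k) N.+1 j.+1) =
  size (incs (stair k) N j.+1) + size (incs (stair k) N j).
Proof.
move=> le_kN; rewrite size_incsS [stair k j <= N](_ : _ = true) ?mul1n //.
by rewrite /stair; case: ltnP => //; lia.
Qed.

(** The reflection principle, as the closed form of a recurrence: in the
    region [2 * j <= N + 2] both sides obey the Pascal rule, and on the
    boundary [N = 2 * j - 2] the left count is zero while the two binomial
    coefficients agree by symmetry. The factor [1 < j] is there because
    ['C(N, j - 2)] would be 1 for [j < 2], the subtraction being truncated. *)
Lemma size_stair_ballot k N j : j <= k -> 2 * j <= N + 2 ->
  size (incs (stair k) N j) + (1 < j) * 'C(N, j - 2) = 'C(N, j).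
Proof.
elim: N j => [|N IHN] [|j] le_jk le_jN; rewrite ?incs0 ?bin0 //.
  by have -> : j = 0 by lia.
have [lt_Nj|le_j] := ltnP N (2 * j).
  rewrite (@size_stair_eq0 k j.+1) //=.
  have -> : N.+1 = 2 * j by lia.
  case: j le_jk le_jN lt_Nj => [|j] le_jk le_jN lt_Nj; first by lia.
  rewrite [1 < _]/= mul1n add0n -[RHS]bin_sub; last by lia.
  by congr 'C(_, _); lia.
rewrite size_incsS /stair ifT // le_j mul1n -/(stair k).
have IH1 : _ = 'C(N, j.+1) := IHN j.+1 le_jk ltac:(lia).
have IH0 : _ = 'C(N, j) := IHN j (ltnW le_jk) ltac:(lia).
rewrite binS -{}IH1 -{}IH0.
case: j le_jk le_jN le_j => [|[|j]] le_jk le_jN le_j /=.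
- by rewrite !mul0n !addn0.
- by rewrite !subnn !bin0; lia.
- by rewrite !subSS !subn0 binS; lia.
Qed.

(** The range is where the bound on [n] holds and the count may be nonzero:
    for [j = K] the bound on the largest element is [n > 3 * K], and for
    [j > K] there is no list unless [n - j.+1 > 2 * K]. *)
Lemma card_SSch K n :
  #|` SSch K.+1 n| = \sum_(K <= j < n - 2 * K) size (incs (stair K.+1) (n - j.+1) j).
Proof.
have rank_SSch F : F \in SSch K.+1 n -> K < #|` F| <= n.
  rewrite !inE /= => /andP[sub /andP[/and3P[_ -> _] _]].
  move: sub; rewrite fpowersetE => /fsubset_leq_card /leq_trans; apply.
  by rewrite card_fseq undup_id ?iota_uniq // size_iota.
have -> : #|` SSch K.+1 n| =
    \sum_(K <= j < n) count (fun F : {fset nat} => #|` F| == j.+1) (SSch K.+1 n).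
  under eq_bigr => j _ do rewrite -sum1_count big_mkcond /=.
  rewrite exchange_big /= -sum1_size; apply: eq_big_seq => F /rank_SSch.
  case: #|` F| => [//|m] /andP[le_Km lt_mn].
  rewrite -big_mkcond sum1_count /= (eq_count (a2 := pred1 m)).
    by rewrite count_uniq_mem ?iota_uniq // mem_index_iota -ltnS le_Km lt_mn.
  by move=> j; rewrite /= eqSS eq_sym.
have zero m : n - 2 * K <= m -> K <= m ->
   (m + stair K.+1 m < n) * size (incs (stair K.+1) (n - m.+1) m) = 0.
  move=> le_m le_Km; have [lt_Km|eq_Km] : K < m \/ m = K by lia.
    by rewrite (@size_stair_eq0 _ K.+1) ?muln0 //=; lia.
  by rewrite eq_Km /stair ltnSn; case: ltnP => //; lia.
have one m : m < n - 2 * K -> K <= m -> m + stair K.+1 m < n.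
  by move=> lt_m le_Km; rewrite /stair; case: (ltnP m K.+1); lia.
rewrite (eq_big_nat _ _ (fun j hj => card_SSch_rank _ n _ _)); last first.
  by move=> j /andP[le_Kj _].
have [le_K|lt_K] := leqP K (n - 2 * K).
  rewrite (big_cat_nat (n := n - 2 * K)) ?leq_subr //=.
  rewrite [X in _ + X = _](_ : _ = 0) ?addn0; last first.
    by rewrite big_nat big1 // => j /andP[le_j _]; apply: zero => //; lia.
  by apply: eq_big_nat => j /andP[le_Kj lt_j]; rewrite one ?mul1n.
rewrite [RHS]big_geq 1?ltnW // big_nat big1 // => j /andP[le_Kj _].
by apply: zero => //; lia.
Qed.

(** The Fibonacci recurrence comes from the Pascal rule along the diagonals.
    The remainder is the summand of index [K - 1], which the split of the
    summand of index [K] produces and the sum for [n - 2] does not contain. *)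
Lemma card_SSch_rec K n : 3 * K + 3 <= n ->
  #|` SSch K.+1 n| = #|` SSch K.+1 (n - 1)| + #|` SSch K.+1 (n - 2)|
     + (0 < K) * size (incs (stair K.+1) (n - K.+2) K.-1).
Proof.
move=> le_n; rewrite !card_SSch.
(* The top summand counts lists of more than [K] entries in [[1, 2 * K]]. *)
have -> : n - 2 * K = (n - 1 - 2 * K).+1 by lia.
rewrite big_nat_recr /=; last by lia.
rewrite [X in _ + X](@size_stair_eq0 _ K.+1) ?addn0 //; try lia.
have step j : 0 < j -> j < n - 1 - 2 * K -> size (incs (stair K.+1) (n - j.+1) j) =
   size (incs (stair K.+1) (n - 1 - j.+1) j) + size (incs (stair K.+1) (n - 2 - j.-1.+1) j.-1).
  case: j => // j _ lt_j.
  have -> : n - j.+2 = (n - j.+3).+1 by lia.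
  rewrite size_stairS; last by lia.
  by congr (size (incs _ _ _) + size (incs _ _ _)); lia.
(* For [K = 0] the sums start at [j = 0], where the count is the constant 1
   and does not split. *)
case: K le_n step => [|K] le_n step.
  rewrite mul0n addn0 !muln0 !subn0.
  have -> : n - 1 = (n - 2).+1 by lia.
  rewrite big_nat_recl // [in RHS]big_nat_recl // !incs0 -addnA -big_split /=.
  congr (_ + _); apply: eq_big_nat => j /andP[_ lt_j].
  by rewrite step //; [congr (size (incs _ _ _) + _)|]; lia.
rewrite mul1n /=.
rewrite (eq_big_nat _ _ (F2 := fun j => size (incs (stair K.+2) (n - 1 - j.+1) j) +
  size (incs (stair K.+2) (n - 2 - j.-1.+1) j.-1))); last first.
  by move=> j /andP[lt_Kj lt_j]; apply: step => //; lia.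
rewrite big_split /= -addnA; congr (_ + _).
have -> : n - 1 - 2 * K.+1 = (n - 2 - 2 * K.+1).+1 by lia.
rewrite big_add1 /= big_ltn; last by lia.
by rewrite addnC; congr (_ + size (incs _ _ _)); lia.
Qed.

Local Open Scope ring_scope.

(** * Evaluation of the binomial differences *)

Lemma fact_neq0 c : c`!%:R != 0 :> rat.
Proof. by rewrite pnatr_eq0 -lt0n fact_gt0. Qed.

(** The form with the top written as a sum exposes both factorials of the
    denominator, so that [field] can compare coefficients once all factorials
    are expanded down to common ones. *)
Lemma bin_rat a b : 'C(a + b, a)%:R = (a + b)`!%:R / (a`!%:R * b`!%:R) :> rat.
Proof.
rewrite -(@bin_fact (a + b) a); last by lia.
by rewrite addKn !natrM mulfK // mulf_neq0 ?fact_neq0.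
Qed.

Lemma prod_desc_rat (n k l : nat) : (k + l <= n)%N ->
  \prod_(k <= i < k + l) (n%:R - i%:R) = (n - k)`!%:R / (n - k - l)`!%:R :> rat.
Proof.
elim: l => [|l IHl] le_n; first by rewrite addn0 big_geq // subn0 divff ?fact_neq0.
rewrite addnS big_nat_recr ?leq_addr //= IHl; last by lia.
have -> : (n - k - l)%N = (n - k - l.+1).+1 by lia.
rewrite factS natrM -natrB; last by lia.
have -> : (n - (k + l))%N = (n - k - l.+1).+1 by lia.
by field; rewrite fact_neq0 nat1r pnatr_eq0.
Qed.

(** Paths of length [2 * K] from 0 to 0 that stay above -2, flanked by an up
    step and a down step, are the Dyck paths of length [2 * K.+1]. *)
Lemma ballot_catalan K :
  'C(2 * K, K)%:R - ((1 < K) * 'C(2 * K, K - 2))%:R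
  = 1 / (K.+1 + 1)%:R * 'C(2 * K.+1, K.+1)%:R :> rat.
Proof.
case: K => [|[|j]]; [by []|by []|].
rewrite mul1n.
have -> : (j.+2 - 2 = j)%N by lia.
have -> : (2 * j.+3 = j.+3 + j.+3)%N by lia.
rewrite bin_rat.
have -> : (2 * j.+2 = j.+2 + j.+2)%N by lia.
rewrite bin_rat.
have -> : (j.+2 + j.+2 = j + j.+4)%N by lia.
rewrite bin_rat.
have -> : (j.+3 + j.+3 = (j + j.+4).+2)%N by lia.
have j_ge0 := ler0n rat j.
rewrite !factS !natrM; field.
by rewrite fact_neq0 /=; apply/and4P; split; apply: lt0r_neq0; lra.
Qed.

Lemma ballot_second_value K :
  'C(2 * K + 1, K)%:R - ((1 < K) * 'C(2 * K + 1, K - 2))%:R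
  = 3 / (2 * K.+1 + 1)%:R * 'C(2 * K.+1 + 1, K.+1 + 2)%:R :> rat.
Proof.
case: K => [|[|j]]; [by []|by []|].
rewrite mul1n.
have -> : (j.+2 - 2 = j)%N by lia.
have -> : (2 * j.+3 + 1 = j.+3 + 2 + j.+2)%N by lia.
rewrite bin_rat.
have -> : (2 * j.+2 + 1 = j.+2 + j.+3)%N by lia.
rewrite bin_rat.
have -> : (j.+2 + j.+3 = j + j.+4.+1)%N by lia.
rewrite bin_rat.
have -> : (j.+3 + 2 + j.+2 = (j + j.+4.+1).+2)%N by lia.
have -> : (j.+3 + 2 = j.+4.+1)%N by lia.
have j_ge0 := ler0n rat j.
rewrite !factS !natrM; field.
by rewrite fact_neq0 /=; do ![apply/andP; split]; apply: lt0r_neq0; lra.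
Qed.

(** Over the common denominator [(i + 2)! * (e + 2)!] the numerator is
    [(e + i + 2)!] times
    [(e + 1) * (e + 2) - (i + 1) * (i + 2) = (e - i) * (e + i + 3)]; the last
    factor completes the factorial. *)
Lemma ballot_diff i e :
  'C(e.+2 + i, i.+2)%:R - 'C(e.+2 + i, i)%:R =
  1 / (i.+2)`!%:R * ((e + i).+3`!%:R / e.+2`!%:R) * (e%:R - i%:R) :> rat.
Proof.
have -> : (e.+2 + i = i.+2 + e)%N by lia.
rewrite bin_rat.
have -> : (i.+2 + e = i + e.+2)%N by lia.
rewrite bin_rat.
have -> : ((e + i).+3 = (i + e.+2).+1)%N by lia.
have i_ge0 := ler0n rat i; have e_ge0 := ler0n rat e.
rewrite !factS !natrM; field.
by rewrite !fact_neq0 /=; apply/and4P; split; apply: lt0r_neq0; lra.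
Qed.

Theorem theorem1p4 (k : nat) (hk : (1 <= k)%N) :
  [/\ forall n : nat, (1 <= n <= 3 * k - 3)%N -> #|` SSch k n| = 0%N,
      forall n : nat, n = (3 * k - 2)%N ->
        #|` SSch k n|%:R = 1 / (k + 1)%:R * 'C(2 * k, k)%:R :> rat,
      forall n : nat, n = (3 * k - 1)%N ->
        #|` SSch k n|%:R = 3 / (2 * k + 1)%:R * 'C(2 * k + 1, k + 2)%:R :> rat
    & forall n : nat, (3 * k <= n)%N ->
        #|` SSch k n|%:R - #|` SSch k (n - 1)|%:R - #|` SSch k (n - 2)|%:R
        = (if k == 1%N then 0
           else if k == 2%N then 1
           else if k == 3%N then n%:R - 4
           else 1 / ((k - 2)`!)%:R
                * (\prod_(k <= i < (2 * k - 4).+1) (n%:R - i%:R))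
                * (n%:R - 3 * k%:R + 5)) :> rat].
Proof.
case: k hk => // K _; split=> n.
- by move=> /andP[_ le_n]; rewrite card_SSch big_geq //; lia.
- move=> ->; rewrite card_SSch (_ : _ - 2 * K = K.+1)%N; last by lia.
  rewrite big_nat1 -ballot_catalan (_ : _ - K.+1 = 2 * K)%N; last by lia.
  by rewrite -(@size_stair_ballot K.+1 (2 * K) K) ?natrD ?addrK //; lia.
- move=> ->; rewrite card_SSch (_ : _ - 2 * K = K.+2)%N; last by lia.
  rewrite big_ltn // big_nat1.
  rewrite [X in (_ + X)%N](@size_stair_eq0 _ K.+1) ?addn0 ?leqnn //; last by lia.
  rewrite -ballot_second_value (_ : _ - K.+1 = 2 * K + 1)%N; last by lia.
  by rewrite -(@size_stair_ballot K.+1 (2 * K + 1) K) ?natrD ?addrK //; lia.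
move=> le_n; rewrite card_SSch_rec; last by lia.
have cancel (x y z : rat) : x + y + z - x - y = z by ring.
rewrite !natrD {}cancel.
case: K le_n => [|[|[|i]]] le_n; rewrite ?mul0n ?mul1n //=.
- by rewrite incs0.
- have := @size_stair_ballot 3 (n - 4) 1 isT; rewrite mul0n addn0 bin1 => ->; last by lia.
  by rewrite natrB //; lia.
have ballot := @size_stair_ballot i.+4 (n - i.+4.+1) i.+2.
(* The parameter [e] is chosen so that [e.+2 + i] is the top [n - k - 1] of
   the binomial coefficients, with [k = i + 4]. *)
have [e De] : exists e, n = (e + i + i + 7)%N by exists (n - i - i - 7)%N; lia.
have -> : (2 * i.+4 - 4).+1 = (i.+4 + i.+1)%N by lia.
rewrite prod_desc_rat; last by lia.
have -> : (n - i.+4 - i.+1 = e.+2)%N by lia.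
have -> : (n - i.+4 = (e + i).+3)%N by lia.
have -> : (i.+4 - 2 = i.+2)%N by lia.
have -> : n%:R - 3 * i.+4%:R + 5 = e%:R - i%:R :> rat.
  by rewrite De !natrD -!natr1; ring.
rewrite -ballot_diff.
have -> : (e.+2 + i = n - i.+4.+1)%N by lia.
move: ballot; rewrite mul1n !subSS subn0 => <-; try lia.
by rewrite natrD addrK.
Qed.
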